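(* Let $W$ be an abelian group, let $\omega\in W$, and let $(R_n)_{n\in\mathbb{Z}}$ be a sequence of reciprocity functions $R_n:V_0\to W$. Define a $W$-valued function $\widetilde{\mu}$ on primitive segments as follows: for $n\ge 0$, $\widetilde{\mu}(\infty,n)=\omega+\sum_{k=0}^{n-1}R_k(1,1)$; for $n\ge1$, $\widetilde{\mu}(\infty,-n)=\omega-\sum_{k=1}^{n}R_{-k}(1,1)$; for all $n\in\mathbb{Z}$, $\widetilde{\mu}(n,\infty)=-\widetilde{\mu}(\infty,n)$; for $n\in\mathbb{Z}$ and rationals $0\le a/p<b/q\le 1$ written in lowest terms with $p,q\ge1$ such that $(n+a/p,\,n+b/q)$ is a primitive segment, $\widetilde{\mu}(n+a/p,\,n+b/q)=R_n(p,q)$; and for finite $\alpha<\beta$ with $(\alpha,\beta)$ primitive, $\widetilde{\mu}(\beta,\alpha)=-\widetilde{\mu}(\alpha,\beta)$. Then $\widetilde{\mu}$ satisfies $\widetilde{\mu}(\alpha,\beta)+\widetilde{\mu}(\beta,\alpha)=0$ for all primitive segments and $\widetilde{\mu}(\alpha,\beta)+\widetilde{\mu}(\beta,\gamma)+\widetilde{\mu}(\gamma,\alpha)=0$ whenever $(\alpha,\beta),(\beta,\gamma),(\gamma,\alpha)$ are primitive; hence it extends uniquely to a $W$-valued pseudo-measure $\mu$. Moreover, the data $\{R_n,\omega\}$ are recovered from $\mu$ by $\omega=\mu(\infty,0)$ and $R_n(p,q)=\mu(n+a/p,\,n+b/q)$, where $a/p<b/q$ are the ends of the unique primitive segment contained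 in $[0,1]$ whose ends have (positive) denominators $p$ and $q$.
   Context: $\mathbf{P}^1(\mathbb{Q})=\mathbb{Q}\cup\{\infty\}$. A $W$-valued pseudo-measure is a function $\mu:\mathbf{P}^1(\mathbb{Q})^2\to W$ with $\mu(\alpha,\alpha)=0$, $\mu(\alpha,\beta)+\mu(\beta,\alpha)=0$, $\mu(\alpha,\beta)+\mu(\beta,\gamma)+\mu(\gamma,\alpha)=0$ for all $\alpha,\beta,\gamma$. A primitive segment is an ordered pair $(\alpha,\beta)$ in $\mathbf{P}^1(\mathbb{Q})$ with $\alpha=a/c$, $\beta=b/d$ in lowest terms ($\infty=\pm 1/0$) and $ad-bc=\pm1$. Let $V_0=\{(p,q)\in\mathbb{Z}^2: p\ge1,\ q\ge1,\ \gcd(p,q)=1\}$. A ($W$-valued) reciprocity function is a map $R:V_0\to W$ satisfying $R(p+q,q)+R(p,p+q)=R(p,q)$ for all $(p,q)\in V_0$. The primitive segments contained in $[0,1]$, written $(a/p,b/q)$ with $a/p<b/q$ in lowest terms and $p,q\ge1$, are in bijection with $V_0$ via $(a/p,b/q)\mapsto(p,q)$. *)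

(* Defs.v *)
From mathcomp Require Import all_boot all_order all_algebra.

Set Implicit Arguments.
Unset Strict Implicit.
Unset Printing Implicit Defensive.
Import Order.TTheory GRing.Theory Num.Theory.
Local Open Scope ring_scope.

Definition P1Q : Type := option rat.
Definition infty : P1Q := None.
Definition fin (x : rat) : P1Q := Some x.

(* Lowest terms: [numq]/[denq] at a rational number, and 1/0 at infinity.
   Choosing -1/0 instead does not change [primitive], because of the
   absolute value. *)
Definition num (a : P1Q) : int := if a is Some x then numq x else 1.
Definition den (a : P1Q) : int := if a is Some x then denq x else 0.

Definition primitive (a b : P1Q) : bool :=
  `|num a * den b - num b * den a| == 1.

Lemma primitive_sym a b : primitive a b -> primitive b a.
Proof. by rewrite /primitive distrC. Qed.

Definition primseg : Type := {s : P1Q * P1Q | primitive s.1 s.2}.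

Definition seg (a b : P1Q) (h : primitive a b) : primseg :=
  exist (fun s : P1Q * P1Q => primitive s.1 s.2) (a, b) h.

Definition inV0 (p q : int) : bool := [&& 1 <= p, 1 <= q & coprimez p q].

Definition V0 : Type := {v : int * int | inV0 v.1 v.2}.

Definition v0 (p q : int) (h : inV0 p q) : V0 :=
  exist (fun v : int * int => inV0 v.1 v.2) (p, q) h.

Lemma inV0_11 : inV0 1 1.
Proof. by []. Qed.

Lemma inV0_addl p q : inV0 p q -> inV0 (p + q) q.
Proof.
case/and3P=> hp hq hc; apply/and3P; split=> //.
  by apply: le_trans hp _; rewrite lerDl (le_trans _ hq).
by rewrite coprimez_sym /coprimez gcdzDr gcdzC.
Qed.

Lemma inV0_addr p q : inV0 p q -> inV0 p (p + q).
Proof.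
case/and3P=> hp hq hc; apply/and3P; split=> //.
  by apply: le_trans hp _; rewrite lerDl (le_trans _ hq).
by rewrite /coprimez gcdzDl.
Qed.

Lemma denqDint (n : int) (x : rat) : denq (n%:~R + x) = denq x.
Proof.
have -> : n%:~R + x = (n * denq x + numq x)%:~R / (denq x)%:~R.
  by rewrite rmorphD rmorphM /= mulrDl mulfK ?intq_eq0 ?denq_neq0 //
             divq_num_den.
rewrite coprimeq_den; first by rewrite (negPf (denq_neq0 x)) normr_denq.
rewrite -coprimezE coprimez_sym /coprimez gcdzMDl gcdzC.
by have := coprime_num_den x; rewrite -coprimezE.
Qed.

Lemma primitive_inV0 (n : int) (x y : rat) :
  primitive (fin (n%:~R + x)) (fin (n%:~R + y)) -> inV0 (denq x) (denq y).
Proof.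
rewrite /primitive /= !denqDint => h.
apply/and3P; split; [exact: denq_gt0 | exact: denq_gt0 |].
apply/coprimezP; set a := numq _ in h; set b := numq _ in h.
move: h; rewrite eqr_norml => /andP[/orP[] /eqP h _].
  by exists (- b, a); rewrite /= -h mulNr addrC.
by exists (b, - a); rewrite /= -[RHS]opprK -h opprB mulNr.
Qed.

Definition reciprocity (W : zmodType) (R : V0 -> W) : Prop :=
  forall (p q : int) (h : inV0 p q),
    R (v0 (inV0_addl h)) + R (v0 (inV0_addr h)) = R (v0 h).

Record pseudo_measure (W : zmodType) (mu : P1Q -> P1Q -> W) : Prop := {
  pm_diag : forall a, mu a a = 0;
  pm_anti : forall a b, mu a b + mu b a = 0;
  pm_cocycle : forall a b c, mu a b + mu b c + mu c a = 0 }.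

Record mutilde_clauses (W : zmodType) (omega : W) (R : int -> V0 -> W)
    (mt : primseg -> W) : Prop := {
  mt_infty_nonneg : forall (n : nat) (h : primitive infty (fin n%:R)),
    mt (seg h) = omega + \sum_(0 <= k < n) R k%:Z (v0 inV0_11);
  mt_infty_neg : forall (n : nat) (h : primitive infty (fin (- n%:R))),
    (1 <= n)%N ->
    mt (seg h) = omega - \sum_(1 <= k < n.+1) R (- k%:Z) (v0 inV0_11);
  mt_to_infty : forall (n : int) (h : primitive infty (fin n%:~R)),
    mt (seg (primitive_sym h)) = - mt (seg h);
  mt_unit : forall (n : int) (x y : rat)
      (h : primitive (fin (n%:~R + x)) (fin (n%:~R + y))),
    0 <= x -> x < y -> y <= 1 ->
    mt (seg h) = R n (v0 (primitive_inV0 h));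
  mt_rev : forall (x y : rat) (h : primitive (fin x) (fin y)),
    x < y -> mt (seg (primitive_sym h)) = - mt (seg h) }.

Definition extends (W : zmodType) (mu : P1Q -> P1Q -> W)
    (mt : primseg -> W) : Prop :=
  forall a b (h : primitive a b), mu a b = mt (seg h).

Definition unit_segment (p q : int) (s : rat * rat) : Prop :=
  [/\ 0 <= s.1, s.1 < s.2 & s.2 <= 1] /\
  [/\ primitive (fin s.1) (fin s.2), denq s.1 = p & denq s.2 = q].

(* Main.v *)
(** A pseudo-measure is the coboundary [f b - f a] of the potential
    [f a = mu (infty, a)], so it suffices to build [f] on the rationals and to
    check that its increments along primitive segments are the prescribed ones;
    the antisymmetry and cocycle relations are then automatic.  Every finite
    primitive segment lies in some [n, n+1].  There, the point x cuts 0/1, 1/1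
    in the weighted mediant (i * 0 + j * 1) / (i + j), and the subtractive
    Euclidean algorithm on (i, j) follows its Stern-Brocot path from the segment
    of denominators (1, 1); the reciprocity relation says exactly that values
    are additive when a segment is split at its mediant.  Uniqueness of the
    extension holds because each rational is the end of a primitive segment whose
    other end has a smaller denominator, so every point is joined to infinity
    by a chain of primitive segments. *)

Require Import Defs.
From mathcomp Require Import all_boot all_order all_algebra zify.
Import Order.TTheory GRing.Theory Num.Theory.
Set Implicit Arguments.
Unset Strict Implicit.
Unset Printing Implicit Defensive.
Local Open Scope ring_scope.

(** * Values along Stern-Brocot paths *)

(* If r gives the values on segments by denominators, and x = a/p < y = b/q is a
   primitive segment, this is the value on the segment from x to the point
   (i a + j b) / (i p + j q), for coprime i, j; n is fuel, i + j being enough. *)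
Fixpoint walk {W : zmodType} (r : int -> int -> W) (n : nat) (p q : int)
    (i j : nat) : W :=
  if n is n'.+1 then
    if j == 0%N then 0
    else if i == 0%N then r p q
    else if (j <= i)%N then walk r n' p (p + q) (i - j) j
    else r p (p + q) + walk r n' (p + q) q i (j - i)
  else 0.

Lemma walk_fuel {W : zmodType} (r : int -> int -> W) n m p q i j :
  (i + j <= n)%N -> (i + j <= m)%N -> walk r n p q i j = walk r m p q i j.
Proof.
elim: n m p q i j => [|n IHn] [|m] p q i j //=.
- by rewrite leqn0 addn_eq0 => /andP[_ ->].
- by rewrite leqn0 addn_eq0 => _ /andP[_ ->].
move=> hn hm; case: eqP => // j0; case: eqP => // i0.
by case: leqP => ij; [|congr (_ + _)]; apply: IHn; lia.
Qed.

Definition dist {W : zmodType} (r : int -> int -> W) (p q : int) (i j : nat) :=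
  walk r (i + j) p q i j.

Lemma dist_left {W : zmodType} (r : int -> int -> W) p q i j :
  (j <= i)%N -> dist r p q i j = dist r p (p + q) (i - j) j.
Proof.
move=> ji; rewrite /dist (@walk_fuel W r (i + j) (i + j).+1) //=.
case: eqP => [->|j0]; first by case: (i - 0 + 0)%N.
by rewrite ji; case: eqP => [|i0]; [lia | apply: walk_fuel; lia].
Qed.

(** Reciprocity at (p, q) settles i = 0, where the point is the right end. At i = j the walk turns
    left, but both descents reach the mediant. *)
Lemma dist_right {W : zmodType} (r : int -> int -> W) p q i j :
  r (p + q) q + r p (p + q) = r p q -> (0 < j)%N -> (i <= j)%N ->
  dist r p q i j = r p (p + q) + dist r (p + q) q i (j - i).
Proof.
move=> rpq j0 ij; rewrite /dist (@walk_fuel W r (i + j) (i + j).+1) //=.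
rewrite -[j == _]negbK -lt0n j0 /=; case: eqP => [->|i0].
  rewrite subn0; case: j j0 {ij} => // j _ /=.
  by rewrite addrC.
case: leqP => ji; last by congr (_ + _); apply: walk_fuel; lia.
have -> : i = j by lia.
rewrite !subnn addn0; case: j j0 {ij ji} => // j _ /=.
by case: j => [|j] /=; rewrite !addr0.
Qed.

(** The condition on the weights is a determinant equal to 1, preserved by each subtraction. Two
    such points lie in the same closed half, where induction applies, or are the two ends of the
    segment. *)
Lemma dist_step {W : zmodType} (r : int -> int -> W) :
  (forall p q, inV0 p q -> r (p + q) q + r p (p + q) = r p q) ->
  forall p q i j i' j', inV0 p q -> (i * j' = i' * j + 1)%N ->
  dist r p q i' j' - dist r p q i j =
    r (i%:Z * p + j%:Z * q) (i'%:Z * p + j'%:Z * q).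
Proof.
move=> hr p q i j i' j'.
have [n] := ubnP (i + j + i' + j'); elim: n p q i j i' j' => // n IHn.
move=> p q i j i' j' len hpq det.
have i0 : (0 < i)%N by case: i det {len}; lia.
have j'0 : (0 < j')%N by case: j' det {len}; lia.
case: (leqP j i) => ji; case: (leqP j' i') => ji'.
- rewrite (dist_left _ _ _ ji) (dist_left _ _ _ ji').
  have [k ek] : exists k, i = (j + k)%N by exists (i - j)%N; lia.
  have [k' ek'] : exists k, i' = (j' + k)%N by exists (i' - j')%N; lia.
  subst i i'; rewrite !addKn IHn; [|lia|exact: inV0_addr|lia].
  by congr r; lia.
- have [eij | ij] := eqVneq i j.
    (* The left point is the mediant: [dist_right] counts it in the right half, with the other
       point. *)
    subst j; have i1 : i = 1%N.
      have [k ek] : exists k, j' = (i' + k)%N by exists (j' - i')%N; lia.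
      have : (i %| 1)%N by apply/dvdnP; exists k; subst j'; lia.
      by rewrite dvdn1 => /eqP.
    rewrite (dist_right (hr _ _ hpq) j'0 (ltnW ji')).
    rewrite (dist_right (hr _ _ hpq) i0 ji).
    rewrite opprD addrACA subrr add0r IHn; [|lia|exact: inV0_addl|subst; lia].
    by congr r; subst i; lia.
  have [k ek] : exists k, i = (j + k.+1)%N by exists (i - j).-1; lia.
  have [k' ek'] : exists k, j' = (i' + k.+1)%N by exists (j' - i').-1; lia.
  (* Expanding the determinant leaves a vanishing sum of naturals, which forces the weights (1, 0)
     and (0, 1). *)
  have det' : (j + j * k' + k * i' + k + k * k' + i' = 0)%N.
    by move: det; subst i j'; lia.
  have [-> -> -> ->] : [/\ i = 1, j = 0, i' = 0 & j' = 1]%N.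
    have kk' : (k * k' = 0)%N by lia.
    have : (k = 0 \/ k' = 0)%N by case: (k) (k') kk' => [|?] [|?]; lia.
    by split; lia.
  by rewrite /dist /= subr0; congr r; lia.
- by have := leq_mul (ltnW ji) ji'; lia.
have [k ek] : exists k, j = (i + k)%N by exists (j - i)%N; lia.
have [k' ek'] : exists k, j' = (i' + k)%N by exists (j' - i')%N; lia.
rewrite (dist_right (hr _ _ hpq) j'0 (ltnW ji')).
rewrite (dist_right (hr _ _ hpq) (leq_ltn_trans (leq0n _) ji) (ltnW ji)).
subst j j'.
rewrite opprD addrACA subrr add0r !addKn IHn; [|lia|exact: inV0_addl|lia].
by congr r; lia.
Qed.

(** * Lowest terms and primitive segments *)

Lemma frac_lowest (n d : int) : 0 < d -> coprimez n d ->
  numq (n%:~R / d%:~R) = n /\ denq (n%:~R / d%:~R) = d.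
Proof.
rewrite coprimezE => d0 nd; rewrite coprimeq_num // coprimeq_den // gt_eqF //.
by rewrite gtr0_sg // mul1r gtr0_norm.
Qed.

Lemma numqDint (n : int) (x : rat) : numq (n%:~R + x) = n * denq x + numq x.
Proof.
apply: (@intr_inj rat); rewrite numqE denqDint mulrDl -numqE.
by rewrite rmorphD rmorphM.
Qed.

Lemma ltq_numq (x y : rat) : (x < y) = (numq x * denq y < numq y * denq x).
Proof. exact: lt_ratE. Qed.

Lemma leq_numq (x y : rat) : (x <= y) = (numq x * denq y <= numq y * denq x).
Proof. exact: le_ratE. Qed.

Lemma primitive_lt (x y : rat) : x < y -> primitive (fin x) (fin y) ->
  numq y * denq x = numq x * denq y + 1.
Proof. by rewrite ltq_numq /primitive /= => + /eqP; lia. Qed.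

Lemma primitiveDint (n : int) (x y : rat) :
  primitive (fin (n%:~R + x)) (fin (n%:~R + y)) = primitive (fin x) (fin y).
Proof.
rewrite /primitive /= !denqDint !numqDint; congr (`|_| == 1); lia.
Qed.

(** An integer m strictly between x = a/c and y = b/d would give 1 = (b - m d) c + (m c - a) d >= c
    + d >= 2. *)
Lemma primitive_floor (x y : rat) : x < y -> primitive (fin x) (fin y) ->
  y <= (Num.floor x)%:~R + 1.
Proof.
move=> xy pxy; have det := primitive_lt xy pxy.
have := floorD1_gt x.
rewrite -[1]/(1%:~R) -rmorphD /=; set n := Num.floor x + 1.
rewrite ltq_numq leq_numq numq_int denq_int => xn.
have x0 := denq_gt0 x; have y0 := denq_gt0 y.
move: det xn x0 y0; move: (numq x) (denq x) (numq y) (denq y) => a c b d.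
nia.
Qed.

Lemma primitive_infty (x : rat) :
  primitive infty (fin x) -> exists n : int, x = n%:~R.
Proof.
rewrite /primitive /= mulr0 subr0 mul1r => /eqP x1; exists (numq x).
by rewrite numqE (_ : denq x = 1) ?mulr1 //; have := denq_gt0 x; lia.
Qed.

(** * The potential *)

(* Total version of R, with junk value 0 off V0. *)
Definition extend0 {W : zmodType} (R : V0 -> W) (p q : int) : W :=
  oapp R 0 (insub (p, q)).

Lemma extend0E {W : zmodType} (R : V0 -> W) p q (h : inV0 p q) :
  extend0 R p q = R (v0 h).
Proof. by rewrite /extend0 insubT. Qed.

Lemma reciprocity_extend0 {W : zmodType} (R : V0 -> W) :
  reciprocity R -> forall p q, inV0 p q ->
  extend0 R (p + q) q + extend0 R p (p + q) = extend0 R p q.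
Proof.
move=> hR p q h; rewrite (extend0E _ h) (extend0E _ (inV0_addl h)).
by rewrite (extend0E _ (inV0_addr h)) hR.
Qed.

(** On [0, 1], a/c is the mediant of 0/1 and 1/1 with weights c - a and a; the absolute values only
    convert to [nat]. *)
Definition unit_dist {W : zmodType} (r : int -> int -> W) (x : rat) : W :=
  dist r 1 1 `|denq x - numq x|%N `|numq x|%N.

Lemma unit_dist_step {W : zmodType} (R : V0 -> W) (x y : rat) :
  reciprocity R -> 0 <= x -> x < y -> y <= 1 -> primitive (fin x) (fin y) ->
  unit_dist (extend0 R) y - unit_dist (extend0 R) x =
    extend0 R (denq x) (denq y).
Proof.
move=> hR x0 xy y1 pxy; have det := primitive_lt xy pxy.
have x1 := le_trans (ltW xy) y1; have y0 := le_trans x0 (ltW xy).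
move: x0 x1 y0 y1; rewrite !leq_numq /= !mul1r !mulr1 !mul0r => x0 x1 y0 y1.
rewrite /unit_dist (dist_step (reciprocity_extend0 hR)) //.
  by congr extend0; rewrite !mulr1; lia.
apply/eqP; rewrite -eqz_nat PoszD !PoszM !gez0_abs; lia.
Qed.

Definition int_value {W : zmodType} (omega : W) (r : int -> W) (n : int) : W :=
  match n with
  | Posz m => omega + \sum_(0 <= k < m) r k%:Z
  | Negz m => omega - \sum_(1 <= k < m.+2) r (- k%:Z)
  end.

(** One recurrence covers both sums; the separate case n = -1 is the step that reaches 0. *)
Lemma int_valueS {W : zmodType} (omega : W) (r : int -> W) n :
  int_value omega r (n + 1) = int_value omega r n + r n.
Proof.
case: n => [m|[|m]].
- by rewrite -PoszD addn1 /= big_nat_recr //= addrA.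
- by rewrite /= big_nat1 big_geq // addr0 subrK.
have -> : Negz m.+1 + 1 = Negz m by lia.
by rewrite /= [in RHS]big_nat_recr //= opprD addrA NegzE subrK.
Qed.

Definition potential {W : zmodType} (omega : W) (R : int -> V0 -> W)
    (a : P1Q) : W :=
  if a is Some x then
    let n := Num.floor x in
    int_value omega (fun n => R n (v0 inV0_11)) n
      + unit_dist (extend0 (R n)) (x - n%:~R)
  else 0.

(** At x = 1 the floor jumps to n + 1; [int_valueS] makes the two expressions agree, as the whole
    unit segment has value [R n] at (1, 1). *)
Lemma potential_unit {W : zmodType} (omega : W) (R : int -> V0 -> W) n x :
  0 <= x <= 1 ->
  potential omega R (fin (n%:~R + x)) =
    int_value omega (fun n => R n (v0 inV0_11)) n + unit_dist (extend0 (R n)) x.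
Proof.
case/andP=> x0; rewrite le_eqVlt => /orP[/eqP->|x1] /=; last first.
  rewrite (@floor_def _ _ n) ?[_ + x]addrC ?addrK //.
  by rewrite lerDr x0 rmorphD /= [_ + 1]addrC ltrD2r.
rewrite -(intrD rat n 1) intrKfloor subrr int_valueS.
rewrite -addrA; congr (_ + _).
have -> : unit_dist (extend0 (R n)) 1 = R n (v0 inV0_11).
  by rewrite -extend0E.
have -> : unit_dist (extend0 (R (n + 1))) 0 = 0 by [].
by rewrite addr0.
Qed.

Lemma potential_int {W : zmodType} (omega : W) (R : int -> V0 -> W) n :
  potential omega R (fin n%:~R) = int_value omega (fun n => R n (v0 inV0_11)) n.
Proof. by rewrite -[n%:~R]addr0 potential_unit // addr0. Qed.

Lemma potential_step {W : zmodType} (omega : W) (R : int -> V0 -> W) n x y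
    (h : primitive (fin (n%:~R + x)) (fin (n%:~R + y))) :
  reciprocity (R n) -> 0 <= x -> x < y -> y <= 1 ->
  potential omega R (fin (n%:~R + y)) - potential omega R (fin (n%:~R + x)) =
    R n (v0 (primitive_inV0 h)).
Proof.
move=> hR x0 xy y1; rewrite !potential_unit.
- rewrite opprD addrACA subrr add0r unit_dist_step //; first exact: extend0E.
  by rewrite -(primitiveDint n).
- by rewrite x0 (le_trans (ltW xy)).
- by rewrite y1 (le_trans x0 (ltW xy)).
Qed.

(** * Coboundaries and the prescribed values *)

Definition coboundary {W : zmodType} (f : P1Q -> W) (a b : P1Q) : W := f b - f a.

Lemma pseudo_measure_coboundary {W : zmodType} (f : P1Q -> W) :
  pseudo_measure (coboundary f).
Proof.
split=> [a | a b | a b c]; rewrite /coboundary.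
- exact: subrr.
- by rewrite -opprB addNr.
- by rewrite (addrC (f b - f a)) !addrA !subrK subrr.
Qed.

Lemma mutilde_clauses_potential {W : zmodType} (omega : W) (R : int -> V0 -> W) :
  (forall n, reciprocity (R n)) ->
  mutilde_clauses omega R
    (fun s => coboundary (potential omega R) (val s).1 (val s).2).
Proof.
move=> hR; split=> [n h | [|n] h // _ | n h | n x y h | x y h _];
  rewrite /coboundary /=.
- by rewrite subr0; exact: (potential_int omega R (Posz n)).
- by rewrite subr0; exact: (potential_int omega R (Negz n)).
- by rewrite sub0r subr0.
- exact: potential_step.
- by rewrite opprB.
Qed.

Lemma primitive_irr a : ~~ primitive a a.
Proof. by rewrite /primitive subrr. Qed.

Lemma seg_irr a b (h h' : primitive a b) : seg h = seg h'.
Proof. by rewrite (bool_irrelevance h h'). Qed.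

(** The clauses reach every primitive segment: an infinite end forces the other to be an integer,
    and a finite increasing segment fits in a unit interval. *)
Lemma mutilde_clauses_unique {W : zmodType} (omega : W) (R : int -> V0 -> W) mt mt' :
  mutilde_clauses omega R mt -> mutilde_clauses omega R mt' -> mt' =1 mt.
Proof.
move=> H H' [[a b] /= h]; rewrite -/(seg h).
have to_fin (y : rat) (hy : primitive infty (fin y)) : mt' (seg hy) = mt (seg hy).
  have [n ?] := primitive_infty hy; subst y.
  case: n hy => n hy; first by rewrite (mt_infty_nonneg H) (mt_infty_nonneg H').
  by rewrite (@mt_infty_neg _ _ _ _ H n.+1) // (@mt_infty_neg _ _ _ _ H' n.+1).
have increasing (x y : rat) (hxy : primitive (fin x) (fin y)) :
    x < y -> mt' (seg hxy) = mt (seg hxy).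
  move=> xy; have := primitive_floor xy hxy; have := floor_le x.
  move: (Num.floor x) => n nx yn.
  have [x0 ex] : exists x0, x = n%:~R + x0 by exists (x - n%:~R); rewrite subrKC.
  have [y0 ey] : exists y0, y = n%:~R + y0 by exists (y - n%:~R); rewrite subrKC.
  subst x y; rewrite lerDl in nx; rewrite lerD2l in yn; rewrite ltrD2l in xy.
  by rewrite (mt_unit H) ?(mt_unit H').
case: a b h => [x|] [y|] h.
- case: (ltgtP x y) => xy; first exact: increasing.
    rewrite (seg_irr h (primitive_sym (primitive_sym h))).
    by rewrite (mt_rev H) // (mt_rev H') // increasing.
  by subst y; case/negP: (primitive_irr (fin x)).
- have h' := primitive_sym h; rewrite (seg_irr h (primitive_sym h')).
  have [n ?] := primitive_infty h'; subst x.
  by rewrite (mt_to_infty H) (mt_to_infty H') to_fin.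
- exact: to_fin.
- by case/negP: (primitive_irr infty).
Qed.

(** * Bezout neighbours and uniqueness *)

Lemma bezout_bounded (p q : int) : 0 < q -> coprimez p q ->
  exists a b : int, [/\ b * p = a * q + 1, 1 <= b & b <= q].
Proof.
move=> q0 /coprimezP[[u v] /= uv].
have q1 : q != 0 by rewrite gt_eqF.
(* Shifting by 1 picks the representative of u modulo q in [1, q] instead of [0, q - 1]. *)
exists (- v - ((u - 1) %/ q)%Z * p), (((u - 1) %% q)%Z + 1).
have e := divz_eq (u - 1) q; have := modz_ge0 (u - 1) q1.
have := ltz_pmod (u - 1) q0.
move: e; move: ((u - 1) %/ q)%Z ((u - 1) %% q)%Z => k r e rq r0.
split; [|lia|lia].
have -> : r = u - 1 - k * q by rewrite e; lia.
by rewrite -uv; lia.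
Qed.

(** If x = p/q and b p = a q + 1 with 1 <= b <= q, then (p - a)/(q - b) is a neighbour of smaller
    denominator; b = q forces q = 1 and gives infinity. *)
Lemma smaller_neighbour (x : rat) :
  exists z : P1Q, primitive z (fin x) /\ den z < denq x.
Proof.
have x0 := denq_gt0 x.
have cx : coprimez (numq x) (denq x) by rewrite coprimezE coprime_num_den.
have [a [b [e b1 bx]]] := bezout_bounded x0 cx.
have [bE|bN] := eqVneq b (denq x).
  exists infty; split=> //.
  have : (denq x %| 1)%Z by apply/dvdzP; exists (numq x - a); subst b; lia.
  by rewrite /primitive /= dvdz1; lia.
have c0 : 0 < denq x - b by lia.
have cz : coprimez (numq x - a) (denq x - b).
  apply/coprimezP; exists (denq x, - numq x) => /=; lia.
have [nE dE] := frac_lowest c0 cz.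
exists (fin ((numq x - a)%:~R / (denq x - b)%:~R)).
by rewrite /primitive /= nE dE; split; lia.
Qed.

(** Induction on the denominator, infinity having denominator 0, compares the values from infinity;
    the cocycle relation does the rest. *)
Lemma pseudo_measure_ext {W : zmodType} (mu mu' : P1Q -> P1Q -> W) :
  pseudo_measure mu -> pseudo_measure mu' ->
  (forall a b, primitive a b -> mu a b = mu' a b) -> mu =2 mu'.
Proof.
move=> H H' eq_prim.
have tri (nu : P1Q -> P1Q -> W) : pseudo_measure nu ->
    forall a b c, nu a c = nu a b + nu b c.
  move=> K a b c; rewrite -[LHS]opprK (addr0_eq (pm_anti K a c)).
  by rewrite -(addr0_eq (pm_cocycle K a b c)) opprK.
have eq_infty a : mu infty a = mu' infty a.
  have [n] := ubnP `|den a|%N; elim: n a => // n IHn [x|] /= lt_n; last first.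
    by rewrite (pm_diag H) (pm_diag H').
  have [z [pz lt_z]] := smaller_neighbour x.
  rewrite (tri _ H _ z) (tri _ H' _ z) (eq_prim z) // IHn //.
  have : 0 <= den z by case: (z) => [y|] //=; apply: denq_ge0.
  by lia.
move=> a b; rewrite (tri _ H _ infty) (tri _ H' _ infty) eq_infty.
by rewrite -(addr0_eq (pm_anti H infty a)) -(addr0_eq (pm_anti H' infty a)) eq_infty.
Qed.

Lemma unit_segment_unique (p q : int) : inV0 p q ->
  exists s : rat * rat, unique (unit_segment p q) s.
Proof.
case/and3P=> p1 q1 cpq.
have p0 : 0 < p by lia.
have q0 : 0 < q by lia.
have [a [b [e b1 bq]]] := bezout_bounded q0 cpq.
have [na da] : numq (a%:~R / p%:~R) = a /\ denq (a%:~R / p%:~R) = p.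
  by apply: frac_lowest => //; apply/coprimezP; exists (- q, b) => /=; lia.
have [nb db] : numq (b%:~R / q%:~R) = b /\ denq (b%:~R / q%:~R) = q.
  by apply: frac_lowest => //; apply/coprimezP; exists (p, - a) => /=; lia.
have a0 : 0 <= a.
  have bp0 : 0 < b * p by apply: mulr_gt0; lia.
  by rewrite -(pmulr_lge0 _ q0); lia.
exists (a%:~R / p%:~R, b%:~R / q%:~R); split.
  split; first split; rewrite /= ?leq_numq ?ltq_numq ?na ?da ?nb ?db /=.
  - by rewrite mul0r mulr1.
  - by lia.
  - by rewrite mul1r mulr1.
  by split; rewrite // /primitive /= na da nb db; lia.
case=> x y [[/= x0 xy y1] [pxy dx dy]].
have := primitive_lt xy pxy; rewrite dx dy => e'.
(* Subtracting the two determinant relations shows that [numq y] and b agree modulo q; both lie in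
   [1, q], so they are equal. *)
have : (q %| (numq y - b) * p)%Z by apply/dvdzP; exists (numq x - a); lia.
rewrite Gauss_dvdzl; last by rewrite coprimez_sym.
case/dvdzP=> k ek.
move: y1 x0; rewrite !leq_numq /= dx dy mul0r mul1r !mulr1 => y1 x0.
have yb : numq y = b.
  have xq : 0 <= numq x * q by rewrite mulr_ge0 // ltW.
  have y_gt0 : 0 < numq y by rewrite -(pmulr_lgt0 _ p0); lia.
  by have : k = 0 by [nia]; lia.
have xa : numq x = a.
  by apply: (mulIf (lt0r_neq0 q0)); move: e'; rewrite yb; lia.
by congr pair; rewrite -[RHS]divq_num_den ?dx ?dy ?xa ?yb.
Qed.

Theorem theorem1p11 (W : zmodType) (omega : W) (R : int -> V0 -> W)
    (hR : forall n : int, reciprocity (R n)) :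
  exists mt : primseg -> W,
    (mutilde_clauses omega R mt /\
     forall mt' : primseg -> W, mutilde_clauses omega R mt' -> mt' =1 mt) /\
    (forall (a b : P1Q) (h : primitive a b),
       mt (seg h) + mt (seg (primitive_sym h)) = 0) /\
    (forall (a b c : P1Q)
       (hab : primitive a b) (hbc : primitive b c) (hca : primitive c a),
       mt (seg hab) + mt (seg hbc) + mt (seg hca) = 0) /\
    exists mu : P1Q -> P1Q -> W,
      (pseudo_measure mu /\ extends mu mt) /\
      (forall mu' : P1Q -> P1Q -> W,
         pseudo_measure mu' -> extends mu' mt -> mu' =2 mu) /\
      omega = mu infty (fin 0) /\
      (forall (p q : int) (h : inV0 p q),
         exists s : rat * rat,
           unique (unit_segment p q) s /\
           forall n : int,
             R n (v0 h) = mu (fin (n%:~R + s.1)) (fin (n%:~R + s.2))).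
Proof.
pose mu := coboundary (potential omega R).
have mu_pm : pseudo_measure mu := pseudo_measure_coboundary _.
(* As a restriction of [mu], [mt] inherits both relations and is extended by [mu]. *)
pose mt (s : primseg) := mu (val s).1 (val s).2.
have mt_clauses : mutilde_clauses omega R mt := mutilde_clauses_potential omega hR.
exists mt; split; first by split=> // mt'; apply: mutilde_clauses_unique.
split=> [a b h|]; first exact: pm_anti.
split=> [a b c hab hbc hca|]; first exact: pm_cocycle.
exists mu; split; first by split.
split=> [mu' mu'_pm mu'_ext|].
  by apply: pseudo_measure_ext => // a b h; rewrite (mu'_ext a b h).
split=> [|p q h].
  by rewrite /mu /coboundary (potential_int omega R 0) /= subr0 big_geq // addr0.
have [[x y] s_uniq] := unit_segment_unique h; exists (x, y); split=> //= n.
have [[[/= x0 xy y1] [pxy dx dy]] _] := s_uniq.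
have hn : primitive (fin (n%:~R + x)) (fin (n%:~R + y)) by rewrite primitiveDint.
rewrite /mu /coboundary (potential_step omega hn) //.
subst p q; rewrite /v0; congr (R n (exist _ _ _)); exact: bool_irrelevance.
Qed.
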